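(* If $G$ is a graph and $t\geq 2$, then $\iota(S_G^t) \leq \xi(S_G^2)\cdot n(G)^{t-2}$.
   Context: All graphs are finite and simple, $n(G)=|V(G)|$. For a graph $G=(V,E)$ and integer $t\ge1$, the generalized Sierpiński graph $S_G^t$ has vertex set $V^t$ (words $u_1\ldots u_t$), and $u=u_1\ldots u_t$, $v=v_1\ldots v_t$ are adjacent iff there is $i\in[t]$ with $u_j=v_j$ for $j<i$, $u_i\ne v_i$ and $u_iv_i\in E$, and $u_j=v_i$, $v_j=u_i$ for all $j>i$. Vertices $xx\ldots x$ are extreme vertices. A set $A$ of vertices is isolating if no two vertices outside the closed neighborhood $N[A]$ are adjacent; $\iota$ is the minimum size of an isolating set and $\gamma$ the domination number. Let $\mathcal{I}(S_G^2)$ be the set of isolating sets $D$ of $S_G^2$ with $|D|\le\gamma(S_G^2)$, and $\xi(S_G^2)=\min\{|D|: D\in\mathcal{I}(S_G^2)$ such that whenever $ii,jj\in V(S_G^2)-N[D]$ we have $ij\notin E(G)\}$. *)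

(* Defs.v *)
From mathcomp Require Import all_boot.
Set Implicit Arguments.
Unset Strict Implicit.
Unset Printing Implicit Defensive.

Record sgraph := SGraph {
  vertex :> finType;
  adj : rel vertex;
  adj_sym : symmetric adj;
  adj_irrefl : irreflexive adj }.

Section Domination.
Variable G : sgraph.

Definition closed_nbhd (A : {set G}) : {set G} :=
  A :|: [set v | [exists a in A, adj a v]].

Definition dominating (A : {set G}) : bool := closed_nbhd A == [set: G].

Definition isolating (A : {set G}) : bool :=
  [forall u : G, forall v : G,
    (u \notin closed_nbhd A) && (v \notin closed_nbhd A) ==> ~~ adj u v].

Lemma dominating_setT : dominating [set: G].
Proof. by rewrite /dominating /closed_nbhd setTU. Qed.

Lemma dominating_isolating (A : {set G}) : dominating A -> isolating A.
Proof.
by move=> /eqP domA; apply/forallP=> u; apply/forallP=> v; rewrite domA !inE.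
Qed.

Definition min_dominating_set : {set G} :=
  [arg min_(A < [set: G] | dominating A) #|A|].

Definition domination_number : nat := #|min_dominating_set|.

Definition isolation_number : nat :=
  #|[arg min_(A < [set: G] | isolating A) #|A|]|.

Lemma min_dominating_setP : dominating min_dominating_set.
Proof.
by rewrite /min_dominating_set; case: arg_minnP => //; apply: dominating_setT.
Qed.

End Domination.

Section Sierpinski.
Variables (G : sgraph) (t : nat).

Definition sierpinski_adj (u v : t.-tuple G) : bool :=
  [exists i : 'I_t,
    [&& [forall j : 'I_t, (j < i) ==> (tnth u j == tnth v j)],
        tnth u i != tnth v i,
        adj (tnth u i) (tnth v i)
      & [forall j : 'I_t, (i < j) ==>
          (tnth u j == tnth v i) && (tnth v j == tnth u i)]]].

Lemma sierpinski_adj_sym : symmetric sierpinski_adj.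
Proof.
move=> u v; apply: eq_existsb => i; rewrite eq_sym adj_sym.
congr [&& _, _, _ & _]; apply: eq_forallb => j; first by rewrite eq_sym.
by rewrite andbC.
Qed.

Lemma sierpinski_adj_irrefl : irreflexive sierpinski_adj.
Proof. by move=> u; apply/existsP=> -[i]; rewrite eqxx /= andbF. Qed.

Definition sierpinski : sgraph := SGraph sierpinski_adj_sym sierpinski_adj_irrefl.

Definition extreme (x : G) : sierpinski := nseq_tuple t x.

End Sierpinski.

Section Xi.
Variable G : sgraph.

Definition small_isolating (D : {set sierpinski G 2}) : bool :=
  isolating D && (#|D| <= domination_number (sierpinski G 2)).

Definition xi_admissible (D : {set sierpinski G 2}) : bool :=
  small_isolating D &&
  [forall i : G, forall j : G,
    (extreme 2 i \notin closed_nbhd D) && (extreme 2 j \notin closed_nbhd D)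
      ==> ~~ adj i j].

(* The full vertex set may be too large to be admissible, so the minimum is
   taken starting from a minimum dominating set, which always is. *)
Definition xi : nat :=
  #|[arg min_(D < min_dominating_set (sierpinski G 2) | xi_admissible D) #|D|]|.

Lemma min_dominating_set_admissible :
  xi_admissible (min_dominating_set (sierpinski G 2)).
Proof.
have domD := min_dominating_setP (sierpinski G 2).
rewrite /xi_admissible /small_isolating dominating_isolating // leqnn /=.
by apply/forallP=> i; apply/forallP=> j; rewrite (eqP domD) !inE.
Qed.

End Xi.

(* Main.v *)
Require Import Defs.
From mathcomp Require Import all_boot.

(** Take an optimal [D] for [xi] and let [D'] be the set of words of length [t]
    whose last two letters form a word of [D]; it has [#|D| * #|G| ^ (t - 2)]
    elements. If the ends of an edge of the Sierpinski graph escape [N[D']],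
    their length-2 suffixes escape [N[D]]. Either the edge lies inside one copy
    of [S_G^2], which [D] being isolating forbids, or the two suffixes are
    extreme vertices [yy] and [xx] with [xy] an edge of [G], which the extra
    condition in the definition of [xi] forbids. *)

Section Suffix.
Variables (G : sgraph) (s m : nat).
Implicit Types u v : (s + m).-tuple G.

Definition word_prefix u : s.-tuple G := [tuple tnth u (lshift m j) | j < s].

Definition word_suffix u : m.-tuple G := [tuple tnth u (rshift s j) | j < m].

Lemma word_suffix_cat (p : s.-tuple G) (q : m.-tuple G) :
  word_suffix [tuple of p ++ q] = q.
Proof. by apply: eq_from_tnth => j; rewrite tnth_mktuple tnth_rshift. Qed.

Lemma cat_prefix_suffix u : [tuple of word_prefix u ++ word_suffix u] = u.
Proof.
apply: eq_from_tnth => j.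
by case: (split_ordP j) => k ->;
  rewrite ?tnth_lshift ?tnth_rshift tnth_mktuple.
Qed.

(** The pivot [i] moves to [rshift s i]; the common prefix only adds agreeing letters before it. *)
Lemma sierpinski_adj_cat (p : s.-tuple G) (q r : m.-tuple G) :
  sierpinski_adj q r ->
  sierpinski_adj [tuple of p ++ q] [tuple of p ++ r].
Proof.
case/existsP=> i /and4P[/forallP eq_qr neq_i adj_i /forallP swap_i].
apply/existsP; exists (rshift s i); rewrite !tnth_rshift neq_i adj_i /=.
apply/andP; split; apply/forallP=> j; apply/implyP;
  case: (split_ordP j) => k ->; rewrite ?tnth_lshift ?tnth_rshift ?eqxx //=.
- by rewrite ltn_add2l => /(implyP (eq_qr k)).
(* A prefix position never comes after the pivot, so the premise is false. *)
- by rewrite ltnNge (leq_trans (ltnW (ltn_ord k)) (leq_addr i s)).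
- by rewrite ltn_add2l => /(implyP (swap_i k)).
Qed.

(** If the pivot lies in the prefix, the whole suffix comes after it, so each suffix repeats the
    pivot letter of the other word; otherwise the pivot conditions restrict to the suffixes. *)
Lemma sierpinski_adj_suffix u v : sierpinski_adj u v ->
  sierpinski_adj (word_suffix u) (word_suffix v) \/
  exists x y, [/\ adj x y, word_suffix u = extreme m y
                         & word_suffix v = extreme m x].
Proof.
case/existsP=> i /and4P[/forallP eq_uv neq_i adj_i /forallP swap_i].
case: (split_ordP i) => k def_i; rewrite {}def_i in eq_uv neq_i adj_i swap_i.
- right; exists (tnth u (lshift m k)), (tnth v (lshift m k)).
  have lt_k (j : 'I_m) : lshift m k < rshift s j.
    exact: leq_trans (ltn_ord k) (leq_addr j s).
  by split=> //; apply: eq_from_tnth => j; rewrite tnth_mktuple tnth_nseq;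
     case/andP: (implyP (swap_i (rshift s j)) (lt_k j)) => /eqP ? /eqP ?.
- left; apply/existsP; exists k; rewrite !tnth_mktuple neq_i adj_i /=.
  apply/andP; split; apply/forallP=> j; apply/implyP=> lt_j;
    rewrite !tnth_mktuple.
  + by apply: (implyP (eq_uv (rshift s j))); rewrite ltn_add2l.
  + by apply: (implyP (swap_i (rshift s j))); rewrite ltn_add2l.
Qed.

Definition suffix_preim (D : {set sierpinski G m}) :
    {set sierpinski G (s + m)} :=
  [set u | word_suffix u \in D].

(** Splitting a word into suffix and prefix injects the preimage into [D] times all words of length
    [s]. *)
Lemma card_suffix_preim (D : {set sierpinski G m}) :
  #|suffix_preim D| <= #|D| * #|G| ^ s.
Proof.
pose f (u : (s + m).-tuple G) := (word_suffix u, word_prefix u).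
have inj_f : injective f.
  pose g (w : m.-tuple G * s.-tuple G) := [tuple of w.2 ++ w.1].
  by apply: (@can_inj _ _ f g) => u; apply: cat_prefix_suffix.
rewrite -card_tuple -cardsT -cardsX -(card_imset _ inj_f).
apply/subset_leq_card/subsetP=> _ /imsetP[u uD ->].
by rewrite !inE andbT; rewrite inE in uD.
Qed.

Lemma closed_nbhd_suffix (D : {set sierpinski G m})
    (u : sierpinski G (s + m)) :
  u \notin closed_nbhd (suffix_preim D) -> word_suffix u \notin closed_nbhd D.
Proof.
apply: contra; rewrite !inE => /orP[-> //|/exists_inP[a aD adj_au]].
apply/orP; right; apply/exists_inP.
(* The neighbour [a] of the suffix is lifted into the copy containing [u]. *)
exists [tuple of word_prefix u ++ a]; first by rewrite inE word_suffix_cat.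
by rewrite -[u in adj _ u]cat_prefix_suffix; apply: sierpinski_adj_cat.
Qed.

End Suffix.

Lemma isolation_number_le (G : sgraph) (A : {set G}) :
  isolating A -> isolation_number G <= #|A|.
Proof.
rewrite /isolation_number; case: arg_minnP => [|B _ minB]; last exact: minB.
exact/dominating_isolating/dominating_setT.
Qed.

Theorem theorem5p1 (G : sgraph) (t : nat) (ht : 2 <= t) :
  isolation_number (sierpinski G t) <= xi G * #|G| ^ (t - 2).
Proof.
(* With [t] in the form [s + 2], words split without type casts. *)
have [s def_t] : exists s, t = s + 2 by exists (t - 2); rewrite subnK.
rewrite {}def_t addnK {t ht} /xi.
case: arg_minnP => [|D admD _]; first exact: min_dominating_set_admissible.
case/andP: admD => /andP[isoD _] extD.
apply: leq_trans (card_suffix_preim G s 2 D).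
apply: isolation_number_le; apply/forallP=> u; apply/forallP=> v.
apply/implyP=> /andP[/closed_nbhd_suffix uD /closed_nbhd_suffix vD].
apply/negP=> /sierpinski_adj_suffix[adj_uv | [x [y [adj_xy def_u def_v]]]].
- have := implyP (forallP (forallP isoD _) _) (introT andP (conj uD vD)).
  by rewrite /= adj_uv.
- rewrite def_u in uD; rewrite def_v in vD.
  (* The letters are swapped: [x] comes from the suffix of [v], hence [vD] first. *)
  have := implyP (forallP (forallP extD x) y) (introT andP (conj vD uD)).
  by rewrite adj_xy.
Qed.
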